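(* Let $M=(M_n)_{n\in\mathbb{N}}$ be an increasing log-convex sequence of real numbers with $M_0=1$. Let $M^{[p]}=(M^{[p]}_n)_{n\in\mathbb{N}}$, $p\in\mathbb{N}$, be an increasing countable family of log-convex sequences, that is, each $M^{[p]}$ is log-convex with $$1=M^{[p]}_0\le M^{[p]}_1\le M^{[p]}_2\le\cdots,\qquad\text{and}\qquad M^{[p]}_j\le M^{[q]}_j\ \text{ for all } j,p,q\in\mathbb{N},\ p\le q.$$ Suppose that every local ring $\mathcal{Q}_1(M^{[p]})$, $p\in\mathbb{N}$, is quasianalytic. If $$\mathcal{O}_1\subsetneq\mathcal{Q}_1(M)\subset\bigcup_{p\in\mathbb{N}}\mathcal{Q}_1(M^{[p]}),$$ then $$\mathcal{Q}_1(M)^{+}\setminus\bigcup_{p\in\mathbb{N}}\mathcal{Q}_1(M^{[p]})\neq\emptyset,$$ i.e. there exists a right-hand side germ in $\mathcal{Q}_1(M)^{+}$ which does not extend to a germ belonging to $\mathcal{Q}_1(M^{[p]})$ for any $p\in\mathbb{N}$.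
   Context: A sequence $N=(N_n)_{n\in\mathbb{N}}$ of positive reals is log-convex if $N_n^2\le N_{n-1}N_{n+1}$ for all $n\ge1$. For an interval $I\subset\mathbb{R}$, $\mathcal{Q}(I,N)$ denotes the class of smooth functions $g:I\to\mathbb{R}$ (with one-sided derivatives at endpoints belonging to $I$) for which there exist constants $C,R>0$ such that $|g^{(n)}(x)|\le C R^n n! N_n$ for all $n\in\mathbb{N}$, $x\in I$. $\mathcal{Q}_1(N)$ is the local ring of germs at $0\in\mathbb{R}$ of functions belonging to $\mathcal{Q}([-\varepsilon,\varepsilon],N)$ for some $\varepsilon>0$; $\mathcal{Q}_1(N)^{+}$ is the local ring of right-hand side germs at $0$ of functions belonging to $\mathcal{Q}([0,\varepsilon],N)$ for some $\varepsilon>0$. $\mathcal{O}_1$ is the local ring of germs at $0\in\mathbb{R}$ of real analytic functions of one variable. The ring $\mathcal{Q}_1(N)$ is quasianalytic if a germ in it whose Taylor series at $0$ vanishes is the zero germ. A right-hand side germ extends to a germ $g$ at $0$ if it is the germ of the restriction of a representative of $g$ to $[0,\varepsilon]$ for some $\varepsilon>0$. *)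

(* Defs.v *)
From HB Require Import structures.
From mathcomp Require Import all_boot all_order all_algebra.
From mathcomp Require Import all_classical all_reals all_analysis.

Set Implicit Arguments.
Unset Strict Implicit.
Unset Printing Implicit Defensive.

Import Order.TTheory GRing.Theory Num.Theory.
Import numFieldNormedType.Exports.

Local Open Scope classical_set_scope.
Local Open Scope ring_scope.

Section DenjoyCarleman.
Variable R : realType.
Implicit Types (N : nat -> R) (I : interval R) (f g : R -> R).

Definition log_convex N : Prop :=
  (forall n, 0 < N n) /\ forall n, N n.+1 ^+ 2 <= N n * N n.+2.

(* The difference quotient is only taken along points of [I]: this is the
   one-sided derivative when [x] is an endpoint of [I]. *)
Definition is_derive_in I f (x l : R) : Prop :=
  (f y - f x) / (y - x) @[y --> within [set` I] x^'] --> l.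

(* [d n] is the [n]-th derivative of [f] on [I]. Functions on [I] are encoded by
   total functions, whose values outside [I] are irrelevant. *)
Definition derivatives_in I f (d : nat -> R -> R) : Prop :=
  {in I, d 0%N =1 f} /\
  forall n, {in I, forall x, is_derive_in I (d n) x (d n.+1 x)}.

Definition DCclass I N f : Prop :=
  exists d : nat -> R -> R, derivatives_in I f d /\
  exists C rho : R, [/\ 0 < C, 0 < rho &
    forall n, {in I, forall x, `|d n x| <= C * rho ^+ n * n`!%:R * N n}].

(* A germ is the equivalence class of its representatives; the classes below
   are sets of germs. *)
Definition germ f : set (R -> R) := [set g | \forall x \near 0, f x = g x].

Definition rgerm f : set (R -> R) :=
  [set g | \forall x \near 0, 0 <= x -> f x = g x].

Definition Q1 N : set (set (R -> R)) :=
  [set G | exists (e : R) f, [/\ 0 < e, DCclass `[- e, e] N f & G = germ f]].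

Definition Q1plus N : set (set (R -> R)) :=
  [set H | exists (e : R) f, [/\ 0 < e, DCclass `[0, e] N f & H = rgerm f]].

Definition analytic_at f (x : R) : Prop :=
  exists a : nat -> R,
    \forall y \near x, pseries a (y - x) @ \oo --> f y.

Definition O1 : set (set (R -> R)) :=
  [set G | exists2 f, (\forall x \near 0, analytic_at f x) & G = germ f].

Definition taylor_coef f (n : nat) : R := derive1n n f 0 / n`!%:R.

Definition quasianalytic N : Prop :=
  forall f, Q1 N (germ f) -> (forall n, taylor_coef f n = 0) ->
    germ f = germ (fun=> 0).

Definition extends_to (H G : set (R -> R)) : Prop :=
  exists2 g, G g & H = rgerm g.

End DenjoyCarleman.

Arguments O1 : clear implicits.

(* Main.v *)
(** Put a_k = 1/(k+1). As Q_1(M) contains non-analytic germs, M outgrows every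
    geometric sequence, so w_k > 0 can be chosen so small that, for every
    c in {0,1}^N, the sum F_c = sum_k c_k w_k / (x + a_k) belongs to Q([0,1], M).
    Let A_m be the set of those c for which F_c extends to [-1/(m+1), 1/(m+1)] in
    the class of M^[m] with both constants equal to m+1. If every germ F_c
    extended, the A_m would cover {0,1}^N. Each A_m is closed by compactness.
    If two elements of A_m differ at exactly one index k with a_k < 1/(m+1), the
    difference D of the extensions equals +-w_k / (x + a_k) on the right of 0, so
    by quasianalyticity (x + a_k) D = +-w_k on the left too, which is absurd at
    -a_k. Hence A_m has empty interior, contradicting Baire's theorem. *)

Require Import Defs.
From HB Require Import structures.
From mathcomp Require Import all_boot all_order all_algebra.
From mathcomp Require Import all_classical all_reals all_analysis.
From mathcomp Require Import ring lra.

Set Implicit Arguments.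
Unset Strict Implicit.
Unset Printing Implicit Defensive.

Import Order.TTheory GRing.Theory Num.Theory.
Import numFieldNormedType.Exports.
Local Open Scope classical_set_scope.
Local Open Scope ring_scope.

(** * Families of derivatives with bounded quadratic Taylor remainders *)

Section Jets.
Variable R : realType.
Implicit Types (a b x y : R) (f : R -> R) (d : nat -> R -> R) (B E N : nat -> R).

(** Clearing the denominator makes the estimate trivial at [y = x], so the punctured neighbourhood
    disappears. *)
Lemma is_derive_inP (I : interval R) f x l : is_derive_in I f x l <->
  forall e, 0 < e -> exists2 r, 0 < r & {in I, forall y, `|y - x| < r ->
    `|f y - f x - (y - x) * l| <= e * `|y - x|}.
Proof.
split=> [/cvgrPdist_le fl e e0|fl].
  have /nbhs_ballP[r /= r0 rP] := fl e e0.
  exists r => // y yI yxr; have [->|yx] := eqVneq y x.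
    by rewrite !subrr mul0r subr0 normr0 mulr0.
  have := rP y; rewrite /= /ball /= distrC => /(_ yxr yx yI) H.
  have yx0 : y - x != 0 by rewrite subr_eq0.
  have -> : f y - f x - (y - x) * l = - ((l - (f y - f x) / (y - x)) * (y - x)).
    by field.
  by rewrite normrN normrM ler_wpM2r.
apply/cvgrPdist_le => e e0; have [r r0 rP] := fl e e0.
apply/nbhs_ballP; exists r => //= y; rewrite /ball /= distrC => yxr yx yI.
have yx0 : y - x != 0 by rewrite subr_eq0.
rewrite -(ler_pM2r (x := `|y - x|)) ?normr_gt0// -normrM.
have -> : (l - (f y - f x) / (y - x)) * (y - x) =
  - (f y - f x - (y - x) * l) by field.
by rewrite normrN rP.
Qed.

Lemma is_derive_in_sub (I J : interval R) f x l : {subset J <= I} ->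
  is_derive_in I f x l -> is_derive_in J f x l.
Proof.
move=> JI /is_derive_inP fl; apply/is_derive_inP => e /fl[r r0 rP].
by exists r => // y /JI; exact: rP.
Qed.

Lemma is_derive_in_interior a b f x l : a < x < b ->
  is_derive_in `[a, b] f x l -> is_derive x 1 f l.
Proof.
move=> /andP[ax xb] /is_derive_inP fl; apply/is_derive1_caratheodory.
exists (fun y => if y == x then l else (f y - f x) / (y - x)); split.
- move=> z; case: eqVneq => [->|zx]; first by rewrite !subrr mulr0.
  by rewrite divfK// subr_eq0.
- apply/cvgrPdist_le => e e0; rewrite eqxx.
  have [r r0 rP] := fl e e0.
  apply/nbhs_ballP; exists (Num.min r (Num.min (x - a) (b - x))) => /=.
    by rewrite !lt_min r0 !subr_gt0 ax.
  move=> y; rewrite /ball /= !lt_min !ltr_norml => /and3P[/andP[yr ry] ya yb].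
  case: eqVneq => [_|yx]; first by rewrite subrr normr0 ltW.
  have yx0 : y - x != 0 by rewrite subr_eq0.
  rewrite -(ler_pM2r (x := `|y - x|)) ?normr_gt0// -normrM.
  have -> : (l - (f y - f x) / (y - x)) * (y - x) =
    - (f y - f x - (y - x) * l) by field.
  by rewrite normrN rP// ?in_itv/= ?ltr_norml; lra.
- by rewrite eqxx.
Qed.

Lemma is_derive_in_continuous a b f (g : R -> R) :
  {in `[a, b], forall x, is_derive_in `[a, b] f x (g x)} ->
  {within `[a, b], continuous f}.
Proof.
move=> fg; apply/subspace_continuousP => x /= xab.
apply/cvgrPdist_le => e e0.
have /is_derive_inP/(_ 1 ltr01)[r r0 rP] := fg x xab.
pose K := 1 + `|g x|; have K0 : 0 < K by rewrite ltr_pwDl.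
have r'0 : 0 < Num.min r (e / K) by rewrite lt_min r0 divr_gt0.
apply/nbhs_ballP; exists (Num.min r (e / K)) => //= y.
rewrite /ball /= distrC lt_min => /andP[yr yK] yab.
have H := rP y yab yr; rewrite [leLHS]distrC.
have : `|f y - f x| <= K * `|y - x|.
  have -> : f y - f x = (f y - f x - (y - x) * g x) + (y - x) * g x by ring.
  rewrite (le_trans (ler_normD _ _))// /K [leRHS]mulrDl lerD//.
  by rewrite normrM mulrC.
move=> /le_trans; apply.
by rewrite mulrC -ler_pdivlMr// ltW.
Qed.

Lemma MVT_in a b f (g : R -> R) : a <= b ->
  {in `[a, b], forall x, is_derive_in `[a, b] f x (g x)} ->
  exists2 c, c \in `[a, b] & f b - f a = g c * (b - a).
Proof.
rewrite le_eqVlt => /predU1P[ab _|ab fg].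
  by exists b; rewrite ?ab ?bound_itvE// !subrr mulr0.
have [x xab|c cab ->] := MVT (df := g) ab _ (is_derive_in_continuous fg).
  by apply: is_derive_in_interior (fg _ (subset_itv_oo_cc xab));
    move: xab; rewrite in_itv.
by exists c => //; exact: subset_itv_oo_cc.
Qed.

Lemma lipschitz_in a b f (g : R -> R) K :
  {in `[a, b], forall x, is_derive_in `[a, b] f x (g x)} ->
  {in `[a, b], forall x, `|g x| <= K} ->
  {in `[a, b] &, forall x y, `|f y - f x| <= K * `|y - x|}.
Proof.
move=> fg gK; suff H : {in `[a, b] &, forall x y, x <= y ->
    `|f y - f x| <= K * `|y - x|}.
  move=> x y xab yab; have [|/ltW] := leP x y; first exact: H.
  by rewrite distrC [`|y - x|]distrC; exact: H.
move=> x y xab yab xy.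
have sub : {subset `[x, y] <= `[a, b]}.
  by apply/subitvP; rewrite subitvE !bnd_simp; rewrite !in_itv/= in xab yab; lra.
have fg' : {in `[x, y], forall z, is_derive_in `[x, y] f z (g z)}.
  by move=> z /[dup] /sub /fg fgz _; exact: is_derive_in_sub fgz.
have [c cxy ->] := MVT_in xy fg'.
by rewrite normrM ler_wpM2r// gK// sub.
Qed.

(* The bounded Taylor remainders make this notion stable under pointwise limits,
   which is what replaces the Arzela-Ascoli theorem below. *)
Definition jet a b d B E := forall n,
  {in `[a, b], forall x, `|d n x| <= B n} /\
  {in `[a, b] &, forall x y,
    `|d n y - d n x - (y - x) * d n.+1 x| <= E n * (y - x) ^+ 2}.

Definition dcbound (C r : R) N n := C * r ^+ n * n`!%:R * N n.

(** The mean value theorem is used twice. It makes [d n.+1] Lipschitz with constant [B n.+2]; hence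
    [h z = d n z - (z - x) * d n.+1 x] has derivative at most [B n.+2 * |y - x|] between [x] and
    [y], which gives the quadratic remainder. *)
Lemma derivatives_jet a b f d B : derivatives_in `[a, b] f d ->
  (forall n, {in `[a, b], forall x, `|d n x| <= B n}) ->
  jet a b d B (fun n => B n.+2).
Proof.
move=> [_ dd] dB n; split=> [|x y xab yab]; first exact: dB.
set K := B n.+2 * `|y - x|.
have B0 : 0 <= B n.+2 := le_trans (normr_ge0 _) (dB n.+2 x xab).
pose I := `[Num.min x y, Num.max x y].
have sub : {subset I <= `[a, b]}.
  move=> z; rewrite /I in_itv/= ge_min le_max => /andP[].
  by move: xab yab; rewrite !in_itv/= => ? ? /orP[?|?] /orP[?|?]; lra.
have xI : x \in I by rewrite in_itv/= ge_min lexx le_max lexx.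
have yI : y \in I by rewrite in_itv/= ge_min lexx orbT le_max lexx orbT.
pose h z := d n z - (z - x) * d n.+1 x.
have hd : {in I, forall z, is_derive_in I h z (d n.+1 z - d n.+1 x)}.
  move=> z zI; apply/is_derive_inP => e e0.
  have /is_derive_inP/(_ e e0)[r r0 rP] := dd n z (sub _ zI).
  exists r => // t tI tr; rewrite /h.
  rewrite [X in `|X| <= _](_ : _ = d n t - d n z - (t - z) * d n.+1 z); last by ring.
  by apply: rP => //; exact: sub.
have dK : {in I, forall z, `|d n.+1 z - d n.+1 x| <= K}.
  move=> z zI; have := lipschitz_in (dd n.+1) (dB n.+2) xab (sub _ zI).
  move=> /le_trans; apply; rewrite ler_wpM2l//.
  move: zI; rewrite /I in_itv/= ge_min le_max ler_norml => /andP[].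
  have := ler_norm (y - x); have := ler_norm (x - y); rewrite distrC.
  by move=> ? ? /orP[?|?] /orP[?|?]; apply/andP; split; lra.
have := lipschitz_in hd dK xI yI.
rewrite /K -mulrA -expr2 real_normK ?num_real//.
rewrite /h subrr mul0r subr0.
by rewrite [in X in X -> _](_ : d n y - _ - _ = d n y - d n x - (y - x) * d n.+1 x); last by ring.
Qed.

Lemma jet_derivatives a b d B E : jet a b d B E -> derivatives_in `[a, b] (d 0%N) d.
Proof.
move=> dj; split=> // n x xab; apply/is_derive_inP => e e0.
pose K := `|E n| + 1; have K0 : 0 < K by rewrite ltr_wpDl.
exists (e / K); first exact: divr_gt0.
move=> y yab yx; have [_ /(_ x y xab yab) /le_trans] := dj n; apply.
rewrite -real_normK ?num_real// expr2 mulrA ler_wpM2r//.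
rewrite (@le_trans _ _ (K * `|y - x|))//.
  by rewrite ler_wpM2r// /K (le_trans (ler_norm _))// lerDl.
by rewrite mulrC -ler_pdivlMr// ltW.
Qed.

Lemma jet_DC a b N d C r E : 0 < C -> 0 < r ->
  jet a b d (dcbound C r N) E -> DCclass `[a, b] N (d 0%N).
Proof.
move=> C0 r0 dj; exists d; split; first exact: jet_derivatives dj.
by exists C, r; split=> // n x xab; have [/(_ x xab)] := dj n.
Qed.

Lemma DC_jet a b N f : DCclass `[a, b] N f -> exists d C r,
  [/\ 0 < C, 0 < r, {in `[a, b], d 0%N =1 f} &
  jet a b d (dcbound C r N) (fun n => dcbound C r N n.+2)].
Proof.
move=> [d [dd [C [r [C0 r0 dB]]]]]; exists d, C, r; split=> //.
- by case: dd.
- exact: derivatives_jet dd dB.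
Qed.

Lemma jet_sub a b a' b' d B E : a <= a' -> b' <= b ->
  jet a b d B E -> jet a' b' d B E.
Proof.
move=> aa bb dj n; have [d1 d2] := dj n.
have sub : {subset `[a', b'] <= `[a, b]}.
  by apply/subitvP; rewrite subitvE !bnd_simp aa.
by split=> [x /sub/d1|x y /sub xab /sub yab]//; exact: d2.
Qed.

Lemma jet_le a b d B E B' E' : (forall n, B n <= B' n) -> (forall n, E n <= E' n) ->
  jet a b d B E -> jet a b d B' E'.
Proof.
move=> BB EE dj n; have [d1 d2] := dj n; split=> [x xab|x y xab yab].
  exact: le_trans (d1 _ _) (BB n).
by rewrite (le_trans (d2 _ _ xab yab))// ler_wpM2r// sqr_ge0.
Qed.

Lemma jetD a b d d' B B' E E' : jet a b d B E -> jet a b d' B' E' ->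
  jet a b (fun n x => d n x + d' n x) (fun n => B n + B' n) (fun n => E n + E' n).
Proof.
move=> j j' n; have [d1 d2] := j n; have [d1' d2'] := j' n.
split=> [x xab|x y xab yab].
  by rewrite (le_trans (ler_normD _ _))// lerD// (d1, d1').
rewrite (_ : _ - _ - _ = (d n y - d n x - (y - x) * d n.+1 x) +
  (d' n y - d' n x - (y - x) * d' n.+1 x)); last by ring.
by rewrite (le_trans (ler_normD _ _))// [leRHS]mulrDl lerD// (d2, d2').
Qed.

Lemma jetZ a b c d B E : jet a b d B E ->
  jet a b (fun n x => c * d n x) (fun n => `|c| * B n) (fun n => `|c| * E n).
Proof.
move=> j n; have [d1 d2] := j n; split=> [x xab|x y xab yab].
  by rewrite normrM ler_wpM2l// d1.
rewrite (_ : _ - _ - _ = c * (d n y - d n x - (y - x) * d n.+1 x)); last by ring.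
by rewrite normrM -mulrA ler_wpM2l// d2.
Qed.

Lemma jet0 a b : jet a b (fun _ _ => 0) (fun=> 0) (fun=> 0).
Proof. by move=> n; split=> [x _|x y _ _]; rewrite ?mul0r ?mulr0 ?subr0 ?subr0 normr0. Qed.

Lemma jet_shift a b t d B E : jet a b d B E ->
  jet (a - t) (b - t) (fun n x => d n (x + t)) B E.
Proof.
move=> j n; have [d1 d2] := j n.
have sub x : x \in `[a - t, b - t] -> x + t \in `[a, b].
  by rewrite !in_itv/= lerBlDr lerBrDr.
split=> [x /sub|x y /sub xab /sub yab]; first exact: d1.
by have := d2 _ _ xab yab; rewrite [y + t - _](_ : _ = y - x) //; ring.
Qed.

End Jets.

(** * Limits of jets along an ultrafilter *)

Section Ultralimits.
Variables (R : realType) (T : Type) (U : set_system T).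
Hypothesis UU : UltraFilter U.
Let PU : ProperFilter U := ultra_proper.

(** The values stay in a compact segment, which provides a cluster point; for an ultrafilter a
    cluster point is a limit. *)
Lemma ultra_bounded_cvg (u : T -> R) (B : R) : (forall k, `|u k| <= B) ->
  cvg (u k @[k --> U]).
Proof.
move=> uB; have UB : (u k @[k --> U]) `[- B, B]%classic.
  by apply: (@filterE _ U) => k; rewrite /= in_itv/= -ler_norml.
have [p [_ clp]] := segment_compact _ UB.
apply/cvg_ex; exists p => V Vp.
have [//|UV] := in_ultra_setVsetC (u @^-1` V) UU.
by have [z [zV /zV]] := clp (~` V) V UV Vp.
Qed.

(** Each condition of a jet is a non-strict inequality between finitely many values, hence survives
    pointwise limits. A single ultrafilter serves all orders and all points at once, so no diagonal
    extraction occurs. *)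
Lemma jet_lim a b (d : T -> nat -> R -> R) B E : (forall k, jet a b (d k) B E) ->
  jet a b (fun n x => lim (d k n x @[k --> U])) B E.
Proof.
move=> dj n.
have dl m x : x \in `[a, b] -> d k m x @[k --> U] --> lim (d k m x @[k --> U]).
  move=> xab; apply: (ultra_bounded_cvg (B := B m)) => k.
  by have [/(_ x xab)] := dj k m.
split=> [x xab|x y xab yab].
  apply: (cvgr_to_le (cvg_norm (dl n x xab))); apply: filterE => k.
  by have [/(_ x xab)] := dj k n.
have H : d k n y - d k n x - (y - x) * d k n.+1 x @[k --> U] -->
    lim (d k n y @[k --> U]) - lim (d k n x @[k --> U])
    - (y - x) * lim (d k n.+1 x @[k --> U]).
  by apply: cvgB; [apply: cvgB; exact: dl|apply: cvgMr; exact: dl].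
apply: (cvgr_to_le (cvg_norm H)); apply: filterE => k.
by have [_ /(_ x y xab yab)] := dj k n.
Qed.

End Ultralimits.

(** * Quasianalyticity as unique continuation from the right of 0 to the left *)

Section UniqueContinuation.
Variable R : realType.
Implicit Types (a b x y : R) (d : nat -> R -> R) (B E N : nat -> R).

Lemma norm_le_linear_eq0 (c K r : R) : 0 < r ->
  (forall h, 0 < h < r -> `|c| <= K * h) -> c = 0.
Proof.
move=> r0 H; apply/eqP; rewrite -normr_le0 leNgt; apply/negP => c0.
have K0 : 0 < `|K| + 1 by rewrite ltr_wpDl.
pose h := Num.min (r / 2) (`|c| / (2 * (`|K| + 1))).
have h0 : 0 < h by rewrite lt_min !divr_gt0// mulr_gt0.
have hr : h < r by rewrite gt_min; apply/orP; left; lra.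
have hc : h <= `|c| / (2 * (`|K| + 1)) by rewrite ge_min lexx orbT.
have := H h; rewrite h0 hr => /(_ isT).
have : K * h <= `|c| / 2.
  rewrite (@le_trans _ _ ((`|K| + 1) * h))//.
    by rewrite ler_wpM2r ?(ltW h0)// (le_trans (ler_norm _))// lerDl.
  rewrite (@le_trans _ _ ((`|K| + 1) * (`|c| / (2 * (`|K| + 1)))))//.
    by rewrite ler_wpM2l// ltW.
  rewrite le_eqVlt; apply/orP; left; apply/eqP; field.
  by rewrite gt_eqF.
by move=> ? ?; lra.
Qed.

(** Letting [h] tend to 0 kills [p]; dividing by [h] then kills [q]. *)
Lemma affine_small_eq0 (p q K r : R) : 0 < r ->
  (forall h, 0 < h < r -> `|p + h * q| <= K * h ^+ 2) -> p = 0 /\ q = 0.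
Proof.
move=> r0 H; have p0 : p = 0.
  apply: (@norm_le_linear_eq0 p (`|q| + `|K| * r) r) => // h hr.
  have /andP[h0 /ltW hr'] := hr.
  have -> : p = (p + h * q) - h * q by ring.
  rewrite (le_trans (ler_normB _ _))// [leRHS]mulrDl addrC lerD//.
    by rewrite normrM (gtr0_norm h0) mulrC.
  rewrite (le_trans (H h hr))// expr2 mulrA ler_wpM2r ?(ltW h0)//.
  rewrite (@le_trans _ _ (`|K| * h))// ?ler_wpM2l//.
  by rewrite ler_wpM2r ?(ltW h0)// ler_norm.
split=> //; apply: (@norm_le_linear_eq0 q K r) => // h hr.
have := H h hr; have /andP[h0 _] := hr.
rewrite p0 add0r normrM (gtr0_norm h0) expr2 mulrA [leRHS]mulrC.
by rewrite ler_pM2l.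
Qed.

(** If [d n] vanishes just to the right of [x], the remainder estimate says that
    [d n x + h * d n.+1 x] is of order [h ^+ 2] for small [h > 0], so both coefficients are 0.
    Induction on [n] covers the open interval, and one more application reaches [s]. *)
Lemma jet_vanish a b d B E s t : jet a b d B E -> a <= s -> s < t -> t <= b ->
  (forall x, s < x < t -> d 0%N x = 0) -> forall n, d n s = 0.
Proof.
move=> dj as_ st tb d0.
have step n x : s <= x < t -> (forall y, s < y < t -> d n y = 0) ->
    d n x = 0 /\ d n.+1 x = 0.
  move=> /andP[sx xt] dn.
  suff : - d n x = 0 /\ - d n.+1 x = 0.
    by move=> [/eqP + /eqP]; rewrite !oppr_eq0 => /eqP-> /eqP->.
  apply: (@affine_small_eq0 _ _ (E n) (t - x)); first by rewrite subr_gt0.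
  move=> h /andP[h0 ht].
  have xab : x \in `[a, b] by rewrite in_itv/=; lra.
  have yab : x + h \in `[a, b] by rewrite in_itv/=; lra.
  have dy : d n (x + h) = 0 by apply: dn; lra.
  have [_ /(_ x (x + h) xab yab)] := dj n; rewrite dy.
  have -> : x + h - x = h by rewrite addrAC subrr add0r.
  by rewrite sub0r -mulrN.
have dn0 n x : s < x < t -> d n x = 0.
  elim: n x => [|n IH] x xst; first exact: d0.
  by have [] := step n x _ IH => //; lra.
by move=> n; have [] := step n s _ (dn0 n) => //; lra.
Qed.

Lemma jet_derive1n a b d B E : jet a b d B E ->
  forall n x, a < x < b -> derive1n n (d 0%N) x = d n x.
Proof.
move=> dj; elim=> // n IH x xab; rewrite derive1nS derive1E.
suff : is_derive x 1 (derive1n n (d 0%N)) (d n.+1 x) by move=> ?; exact: derive_val.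
pose a' := (a + x) / 2; pose b' := (x + b) / 2.
have [/andP[ax' xb'] aa' bb'] : [/\ a' < x < b', a < a' & b' < b].
  by rewrite /a' /b'; split; lra.
have dj' := jet_sub (ltW aa') (ltW bb') dj.
have [_ /(_ n x)] := jet_derivatives dj'; rewrite in_itv/= !ltW// => /(_ isT) ddn.
apply: (is_derive_in_interior (a := a') (b := b')); first by rewrite ax'.
apply/is_derive_inP => e e0; move/is_derive_inP : ddn => /(_ e e0) [r r0 rP].
exists r => // y yab yr; rewrite !IH//; last first.
  by move: yab; rewrite in_itv/=; lra.
exact: rP.
Qed.

(** Let [s] be the supremum of the points of [[z, 0]] where the function is nonzero. It vanishes
    just to the right of [s], so all derivatives vanish at [s]; quasianalyticity, applied after
    translating [s] to 0, makes it vanish near [s], against the choice of [s]. *)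
Lemma quasianalytic_vanish N d C r E e t : quasianalytic N ->
  0 < C -> 0 < r -> 0 < t ->
  jet (- e) e d (dcbound C r N) E -> (forall x, 0 <= x < t -> d 0%N x = 0) ->
  forall x, - e < x <= 0 -> d 0%N x = 0.
Proof.
move=> qN C0 r0 t0 dj dt z /andP[ez z0]; apply/eqP/negP => /negP dz.
pose S := [set x | z <= x <= 0 /\ d 0%N x != 0].
have Sz : S z by split; rewrite ?lexx.
have Ss : has_sup S.
  by split; [exists z|exists 0 => x [/andP[]]].
set s := sup S.
have s0 : s <= 0 by apply: ge_sup => [|x [/andP[]]//]; exists z.
have zs : z <= s by apply: ub_le_sup => //; case: Ss.
pose t' := Num.min t e.
have t'0 : 0 < t' by rewrite lt_min t0; lra.
have [t't t'e] : t' <= t /\ t' <= e by rewrite !ge_min !lexx orbT.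
have ds x : s < x < t' -> d 0%N x = 0.
  move=> /andP[sx xt]; have [x0|x0] := leP 0 x; first by apply: dt; lra.
  apply/eqP/negP => /negP dx; have : x <= s.
    by apply: ub_le_sup; [case: Ss|split=> //; lra].
  by rewrite leNgt sx.
have dsn : forall n, d n s = 0 by apply: (jet_vanish dj) ds; lra.
(* As [s <= 0], the largest symmetric interval around [s] inside [[- e, e]] has radius [e + s]. *)
have := jet_shift s dj; set v := fun n x => d n (x + s) => vj.
have es : 0 < e + s by lra.
have vj' : jet (- (e + s)) (e + s) v (dcbound C r N) E.
  by apply: jet_sub vj; lra.
have Qv : Q1 N (germ (v 0%N)).
  by exists (e + s), (v 0%N); split=> //; exact: jet_DC vj'.
have v0 n : taylor_coef (v 0%N) n = 0.
  by rewrite /taylor_coef (jet_derive1n vj') ?/v ?add0r ?dsn ?mul0r//; lra.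
have : germ (v 0%N) (v 0%N) by apply: filterE.
rewrite (qN _ Qv v0) => /nbhs_ballP[h /= h0 vh].
have [x [xS dx] sx] := sup_adherent h0 Ss.
have xs : x <= s by apply: ub_le_sup => //; case: Ss.
have := vh (x - s); rewrite /ball /= sub0r normrN ler0_norm; last lra.
by rewrite /v subrK => H; move: dx; rewrite -H ?eqxx// opprB ltrBlDl -ltrBlDr.
Qed.

End UniqueContinuation.

(** * Simple poles: their derivatives, and why they obstruct extension *)

Section Poles.
Variable R : realType.
Implicit Types (a b x y : R) (d : nat -> R -> R) (B E N : nat -> R).

Lemma dcboundD C C' (r : R) N n :
  dcbound C r N n + dcbound C' r N n = dcbound (C + C') r N n.
Proof. by rewrite /dcbound !mulrDl. Qed.

Lemma dcboundZ c C (r : R) N n : c * dcbound C r N n = dcbound (c * C) r N n.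
Proof. by rewrite /dcbound !mulrA. Qed.

(** This is the Leibniz rule for the product with [x]. The term [n%:R * d n.-1 x] costs [C / r],
    since one power of [r] is missing and [n * (n-1)! = n!]; at [n = 0] its factor is 0, so the
    value of [n.-1] there is harmless. *)
Lemma jet_mulX a b d C r N E : 0 < r -> 0 <= C -> (forall n, N n <= N n.+1) ->
  {in `[a, b], forall x, `|x| <= 1} -> jet a b d (dcbound C r N) E ->
  exists E', jet a b (fun n x => x * d n x + n%:R * d n.-1 x)
    (dcbound (C + C / r) r N) E'.
Proof.
move=> r0 C0 Nincr ab1 dj.
exists (fun n => E n + (2 * E n + dcbound C r N n.+1) + n%:R * E n.-1).
move=> n; split=> [x xab|x y xab yab].
  rewrite -dcboundD (le_trans (ler_normD _ _))// lerD//.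
    have [/(_ x xab) dB _] := dj n.
    by rewrite normrM (le_trans _ dB)// ler_piMl// ab1.
  case: n => [|n]; rewrite normrM ger0_norm//.
    rewrite mul0r.
    have [/(_ x xab) /(le_trans (normr_ge0 _)) + _] := dj 0%N.
    rewrite /dcbound expr0 fact0 !mulr1 => N0.
    by rewrite mulrAC divr_ge0// ltW.
  have [/(_ x xab) dB _] := dj n.
  rewrite (@le_trans _ _ (n.+1%:R * dcbound C r N n))// ?ler_wpM2l//.
  rewrite /dcbound factS natrM exprS.
  have -> : C / r * (r * r ^+ n) * (n.+1%:R * n`!%:R) * N n.+1 =
    n.+1%:R * (C * r ^+ n * n`!%:R * N n.+1) by field; rewrite gt_eqF.
  by rewrite ler_wpM2l// ler_wpM2l// !mulr_ge0// exprn_ge0// ltW.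
set h := y - x; have h2 : `|h| <= 2.
  rewrite (le_trans (ler_normB _ _))//.
  by have := ab1 x xab; have := ab1 y yab; lra.
pose T n := d n y - d n x - h * d n.+1 x.
have TE m : `|T m| <= E m * h ^+ 2 by have [_ /(_ x y xab yab)] := dj m.
rewrite (_ : _ - _ - _ = x * T n + h * (T n + h * d n.+1 x) + n%:R * T n.-1); last first.
  by rewrite /T; case: n => [|n] /=; rewrite /h; ring.
rewrite [leRHS]mulrDl [X in _ <= X + _]mulrDl.
rewrite (le_trans (ler_normD _ _))// lerD//; last first.
  by rewrite normrM ger0_norm// -mulrA ler_wpM2l.
rewrite (le_trans (ler_normD _ _))// lerD//.
  by rewrite normrM (le_trans _ (TE n))// ler_piMl// ab1.
rewrite mulrDr (le_trans (ler_normD _ _))// [leRHS]mulrDl lerD//.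
  rewrite normrM -mulrA (@le_trans _ _ (2 * `|T n|))//.
    by rewrite ler_wpM2r.
  by rewrite ler_wpM2l.
rewrite mulrA -expr2 normrM ger0_norm ?sqr_ge0// mulrC ler_wpM2r ?sqr_ge0//.
by have [/(_ x xab)] := dj n.+1.
Qed.

Lemma jet_cst a b c :
  jet a b (fun n _ => if n is 0%N then c else 0)
    (fun n => if n is 0%N then `|c| else 0) (fun=> 0).
Proof.
by case=> [|n]; split=> [x _|x y _ _];
  rewrite ?mulr0 ?mul0r ?subrr ?subr0 ?normr0.
Qed.

(** The function [(x + a) * d 0 x - w] stays in the class and vanishes to the right of 0, hence also
    at [- a], where its value is [- w]. *)
Lemma quasianalytic_no_pole N d C r E e t a w : quasianalytic N -> N 0%N = 1 ->
  (forall n, N n <= N n.+1) -> 0 < C -> 0 < r -> 0 < t -> 0 < a -> a < e ->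
  e <= 1 -> w != 0 -> jet (- e) e d (dcbound C r N) E ->
  (forall x, 0 <= x < t -> d 0%N x = w / (x + a)) -> False.
Proof.
move=> qN N0 Nincr C0 r0 t0 a0 ae e1 w0 dj dw.
have N1 n : 0 <= N n.
  by elim: n => [|n IH]; rewrite ?N0// (le_trans IH).
have e1' : {in `[- e, e], forall x, `|x| <= 1}.
  by move=> x; rewrite in_itv/= -ler_norml => /le_trans; apply.
have [E' Xj] := jet_mulX r0 (ltW C0) Nincr e1' dj.
have /= := jetD (jetD Xj (jetZ a dj)) (jet_cst (- e) e (- w)).
set u := (u in jet _ _ u); set E'' := (E in jet _ _ _ _ E) => uj.
pose C' := C + C / r + `|a| * C + `|w|.
have {}uj : jet (- e) e u (dcbound C' r N) E''.
  apply: jet_le uj => // n; rewrite dcboundZ dcboundD -[leRHS]dcboundD lerD2l.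
  case: n => [|n]; first by rewrite /dcbound expr0 fact0 N0 !mulr1 normrN.
  by rewrite /dcbound !mulr_ge0// exprn_ge0// ltW.
have C'0 : 0 < C'.
  have Cr0 : 0 <= C / r by rewrite divr_ge0// ltW.
  have aC0 : 0 <= `|a| * C by rewrite mulr_ge0// ltW.
  by rewrite /C' 3?ltr_wpDr.
have u0 x : 0 <= x < t -> u 0%N x = 0.
  move=> xt; have xa0 : x + a != 0 by rewrite gt_eqF//; lra.
  by rewrite /u /= dw//; field.
have := quasianalytic_vanish qN C'0 r0 t0 uj u0 (x := - a).
rewrite /u /= mul0r addr0 mulNr addNr add0r => H.
by move/eqP: w0; apply; apply/eqP; rewrite -oppr_eq0 H//; lra.
Qed.

Lemma jet_pole a : 0 < a -> jet 0 1
  (fun n x => (-1) ^+ n * n`!%:R * (x + a)^-1 ^+ n.+1)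
  (fun n => n`!%:R * a^-1 ^+ n.+1) (fun n => n.+2`!%:R * a^-1 ^+ n.+3).
Proof.
move=> a0.
have xa x : x \in `[0, 1] -> [/\ 0 <= x, 0 < x + a, 0 <= (x + a)^-1 & (x + a)^-1 <= a^-1].
  rewrite in_itv/= => /andP[x0 _]; have xa0 : 0 < x + a by lra.
  by split=> //; rewrite ?invr_ge0 ?lef_pV2 ?posrE//; lra.
have A0 : 0 <= a^-1 by rewrite invr_ge0 ltW.
move=> n; split=> [x /xa[x0 xa0 u0 uA]|x y /xa[x0 xa0 u0 uA] /xa[y0 ya0 v0 vA]].
  rewrite -mulrA normrM normrX normrN normr1 expr1n mul1r normrM !ger0_norm//.
    by rewrite ler_wpM2l// lerXn2r.
  exact: exprn_ge0.
set h := y - x; set u := (x + a)^-1; set v := (y + a)^-1.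
have uv : u - v = h * u * v.
  by rewrite /u /v /h; field; rewrite !gt_eqF.
(* The remainder estimate for [(x + a)^-1 ^+ m]. The factor [m * m.+1] is chosen so that [m = n.+1],
   multiplied by [n!], gives exactly [(n+2)!]. *)
have key m : `|v ^+ m - u ^+ m + m%:R * h * u ^+ m.+1| <=
    (m * m.+1)%:R * a^-1 ^+ m.+2 * h ^+ 2.
  elim: m => [|m IH]; first by rewrite !expr0 subrr !mul0r addr0 normr0.
  (* The last summand is 0 by [uv]; with it the identity is polynomial in [u], [v] and [h]. *)
  have -> : v ^+ m.+1 - u ^+ m.+1 + m.+1%:R * h * u ^+ m.+2 =
      v * (v ^+ m - u ^+ m + m%:R * h * u ^+ m.+1)
      + m.+1%:R * (u ^+ m.+2 * v) * h ^+ 2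
      + (u - v - h * u * v) * (m.+1%:R * h * u ^+ m.+1 - u ^+ m).
    by rewrite !exprS -natr1; ring.
  rewrite uv subrr mul0r addr0 (le_trans (ler_normD _ _))//.
  have -> : (m.+1 * m.+2)%:R * a^-1 ^+ m.+3 * h ^+ 2 =
      a^-1 * ((m * m.+1)%:R * a^-1 ^+ m.+2 * h ^+ 2)
      + (2 * m.+1)%:R * a^-1 ^+ m.+3 * h ^+ 2 :> R.
    by rewrite !natrM !exprS -!natr1; ring.
  rewrite lerD//.
    by rewrite normrM (ger0_norm v0) ler_pM.
  rewrite normrM [X in _ * X]ger0_norm ?sqr_ge0// ler_wpM2r ?sqr_ge0//.
  rewrite ger0_norm; last by rewrite mulr_ge0// mulr_ge0// exprn_ge0.
  apply: ler_pM => //; first by rewrite mulr_ge0// exprn_ge0.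
    by rewrite ler_nat leq_pmull.
  by rewrite [leRHS]exprSr ler_pM ?exprn_ge0// lerXn2r.
have -> : (-1) ^+ n * n`!%:R * v ^+ n.+1 - (-1) ^+ n * n`!%:R * u ^+ n.+1
    - h * ((-1) ^+ n.+1 * n.+1`!%:R * u ^+ n.+2) =
    (-1) ^+ n * n`!%:R * (v ^+ n.+1 - u ^+ n.+1 + n.+1%:R * h * u ^+ n.+2).
  by rewrite factS natrM (exprS (-1)); ring.
rewrite -mulrA normrM normrX normrN normr1 expr1n mul1r normrM ger0_norm//.
rewrite (le_trans (ler_wpM2l _ (key n.+1)))//.
rewrite !factS !natrM le_eqVlt; apply/orP; left; apply/eqP; ring.
Qed.

End Poles.


(** * Taylor expansion, and the growth of a weight whose class is not analytic *)

Section Taylor.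
Variable R : realType.
Implicit Types (a b x y : R) (d : nat -> R -> R) (B E N : nat -> R).

(** The base point [x] comes last because the sum is studied as a function of it, with the target
    [y] fixed. *)
Definition taylor_sum d n y x := \sum_(i < n) d i x * (y - x) ^+ i / i`!%:R.

(** Differentiation in the base point telescopes, leaving only the term of highest order. *)
Lemma is_derive_taylor_sum a b d B E y : jet a b d B E -> forall n x, a < x < b ->
  is_derive x 1 (taylor_sum d n.+1 y) (d n.+1 x * (y - x) ^+ n / n`!%:R).
Proof.
move=> dj n x xab.
have dd m : is_derive x 1 (d m) (d m.+1 x).
  apply: (is_derive_in_interior xab).
  have [_ /(_ m x)] := jet_derivatives dj; apply.
  by rewrite in_itv/= !ltW//; case/andP: xab.
have dy m : is_derive x 1 (fun z => (y - z) ^+ m.+1) (- (m.+1%:R * (y - x) ^+ m)).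
  have dy1 : is_derive x 1 (fun z => y - z) (-1).
    by apply: is_derive_eq; ring.
  have -> : (fun z => (y - z) ^+ m.+1) = (fun z => y - z) ^+ m.+1.
    by rewrite exprfctE.
  apply: is_derive_eq (is_deriveX m.+1 dy1) _.
  by rewrite /GRing.scale /= mulrN1.
elim: n => [|n IH].
  have -> : taylor_sum d 1 y = d 0%N.
    by apply/funext => z; rewrite /taylor_sum big_ord1 expr0 fact0 mulr1 divr1.
  by rewrite expr0 mulr1 fact0 divr1.
have -> : taylor_sum d n.+2 y =
    taylor_sum d n.+1 y + (fun z => (n.+1`!%:R)^-1) * (d n.+1 * (fun z => (y - z) ^+ n.+1)).
  by apply/funext => z; rewrite /taylor_sum big_ord_recr /= !fctE mulrC.
have cd : is_derive x 1 (fun=> (n.+1`!%:R)^-1 : R) 0 by exact: is_derive_cst.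
apply: is_derive_eq (is_deriveD IH (is_deriveM cd (is_deriveM (dd n.+1) (dy n)))) _.
rewrite /GRing.scale /= !fctE mulr0 addr0 factS natrM; field.
by rewrite nat1r !pnatr_eq0 -lt0n fact_gt0.
Qed.

(* The Cauchy form of the remainder: the factor [n`!] is exactly what is needed
   to compare with the growth [n`! N n] of the derivatives. *)
Lemma taylor_remainder a b d B E n x y : jet a b d B E ->
  a < x < b -> a < y < b ->
  `|d 0%N y - taylor_sum d n.+1 y x| <= B n.+1 * `|y - x| ^+ n.+1 / n`!%:R.
Proof.
move=> dj xab yab.
have yy : taylor_sum d n.+1 y y = d 0%N y.
  rewrite /taylor_sum big_ord_recl expr0 fact0 mulr1 divr1 big1 ?addr0// => i _.
  by rewrite subrr expr0n /= mulr0 mul0r.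
have main u v : u <= v -> a < u < b -> a < v < b ->
  exists2 c, u <= c <= v & taylor_sum d n.+1 y v - taylor_sum d n.+1 y u =
    d n.+1 c * (y - c) ^+ n / n`!%:R * (v - u).
  move=> uv uab vab.
  have [z zuv|| c cuv ->] := MVT_segment (f := taylor_sum d n.+1 y)
    (df := fun c => d n.+1 c * (y - c) ^+ n / n`!%:R) uv.
  - apply: (is_derive_taylor_sum y dj); move: zuv; rewrite in_itv/=; lra.
  - apply: derivable_within_continuous => z; rewrite in_itv/= => zuv.
    have zab : a < z < b by lra.
    by have ? := is_derive_taylor_sum y dj n zab; exact: ex_derive.
  - by exists c => //; move: cuv; rewrite in_itv.
have [c [cab cy Hc]] : exists c, [/\ a < c < b, `|y - c| <= `|y - x| &
    d 0%N y - taylor_sum d n.+1 y x = d n.+1 c * (y - c) ^+ n / n`!%:R * (y - x)].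
  have [xy|/ltW yx] := leP x y.
    have [c cxy] := main x y xy xab yab; rewrite yy => ->; exists c; split=> //.
      lra.
    by rewrite !ger0_norm ?subr_ge0; lra.
  have [c cxy Hc] := main y x yx yab xab; exists c; split.
  - lra.
  - by rewrite distrC [leRHS]distrC !ger0_norm ?subr_ge0; lra.
  - by rewrite -yy -opprB Hc -mulrN opprB.
have cI : c \in `[a, b] by rewrite in_itv/=; lra.
have [/(_ c cI) dB _] := dj n.+1.
rewrite Hc !normrM normrX [`|_^-1|]ger0_norm ?invr_ge0//.
rewrite mulrAC ler_wpM2r ?invr_ge0// exprSr mulrA ler_wpM2r//.
by rewrite ler_pM// ?exprn_ge0// lerXn2r ?nnegrE.
Qed.

(** The remainder is at most [C * n.+1 * (rho * |r| * |y - x|) ^+ n.+1], which tends to 0 for [y]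
    close to [x]. *)
Lemma geometric_Q1_O1 N r : (forall n, N n <= r ^+ n) -> Q1 N `<=` O1 R.
Proof.
move=> Nr G [e [f [e0 /DC_jet[d [C [rho [C0 rho0 df dj]]]] ->]]].
exists f => //.
have r0 : 0 <= `|r| by [].
(* For [|y - x| < q^-1] the ratio is at most [1/4]; half of this decay absorbs [n.+1 <= 2 ^+ n.+1].
   Adding 1 to [|r|] keeps [q] positive. *)
pose q := 4 * (rho * (`|r| + 1)).
have q0 : 0 < q by rewrite !mulr_gt0// ltr_wpDl.
have near_e x : `|x| < e -> exists2 t, 0 < t & forall y, `|y - x| < t -> `|y| < e.
  move=> xe; exists (e - `|x|); first by rewrite subr_gt0.
  move=> y yx; rewrite -[y](subrK x) (le_lt_trans (ler_normD _ _))//.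
  by rewrite -ltrBrDr.
have df' x : `|x| < e -> f x = d 0%N x.
  by move=> xe; rewrite df// in_itv/= -ler_norml ltW.
apply/nbhs_ballP; exists e => //= x; rewrite /ball /= sub0r normrN => xe.
exists (fun i => d i x / i`!%:R).
have [t t0 te] := near_e x xe.
apply/nbhs_ballP; exists (Num.min t q^-1); first by rewrite /= lt_min t0 invr_gt0.
move=> y; rewrite /ball /= lt_min distrC => /andP[/te ye yq].
rewrite df'// -(cvg_shiftS _) /=.
have psE n : pseries (fun i => d i x / i`!%:R) (y - x) n.+1 = taylor_sum d n.+1 y x.
  rewrite /pseries /series /= big_mkord; apply: eq_bigr => i _.
  by rewrite mulrAC.
apply/cvgrPdist_le => eps eps0.
have := cvg_geometric C (z := 1/2); rewrite ger0_norm// => /(_ ltac:(lra)).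
move=> /cvgrPdist_le /(_ eps eps0); apply: filterS => n.
rewrite sub0r normrN /= => /(le_trans _); apply.
rewrite psE (le_trans (taylor_remainder n dj _ _)) -?ltr_norml//.
rewrite (le_trans _ (ler_norm _))//.
have h4 : rho * `|r| * `|y - x| <= 1 / 4.
  rewrite (@le_trans _ _ (q / 4 * q^-1))//; last first.
    by rewrite le_eqVlt; apply/orP; left; apply/eqP; field; rewrite gt_eqF.
  rewrite ler_pM ?mulr_ge0 ?(ltW rho0)//; last exact: ltW.
  rewrite /q mulrAC divff// mul1r ler_wpM2l ?(ltW rho0)//.
  by rewrite lerDl.
have -> : dcbound C rho N n.+1 * `|y - x| ^+ n.+1 / n`!%:R =
   C * (n.+1%:R * (rho ^+ n.+1 * N n.+1 * `|y - x| ^+ n.+1)).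
  by rewrite /dcbound factS natrM; field; rewrite pnatr_eq0 -lt0n fact_gt0.
rewrite /geometric /= ler_wpM2l ?(ltW C0)//.
rewrite (@le_trans _ _ (2 ^+ n.+1 * (1 / 4) ^+ n.+1))//; last first.
  rewrite -exprMn exprS; have -> : 2 * (1 / 4) = 1 / 2 :> R by lra.
  by rewrite ler_piMl// ?exprn_ge0//; lra.
have N0 : `|r| ^+ n.+1 >= N n.+1.
  by rewrite (le_trans (Nr _))// -normrX ler_norm.
rewrite (@le_trans _ _ (n.+1%:R * (rho ^+ n.+1 * `|r| ^+ n.+1 * `|y - x| ^+ n.+1)))//.
  by rewrite ler_wpM2l// ler_wpM2r ?exprn_ge0// ler_wpM2l// exprn_ge0// ltW.
have p0 : 0 <= rho * `|r| * `|y - x| by rewrite !mulr_ge0// ltW.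
rewrite -(exprMn _ rho) -(exprMn _ (rho * _)) ler_pM ?exprn_ge0//.
  by rewrite -natrX ler_nat ltnW// ltn_expl.
by rewrite lerXn2r ?nnegrE.
Qed.

(** Log-convexity makes the ratios [s n] increase. If none exceeded [r], then [N n <= r ^+ n] and
    all germs would be analytic. Once they exceed [r], [r ^+ n / N n] decreases, so its first terms
    bound it. *)
Lemma log_convex_growth N : log_convex N -> ~ (Q1 N `<=` O1 R) -> N 0%N = 1 ->
  forall r, 0 < r -> exists2 W, 0 < W & forall n, r ^+ n <= W * N n.
Proof.
move=> [N0 Nlc] NO N01 r r0.
pose s n := N n.+1 / N n.
have s_incr n : s n <= s n.+1.
  rewrite /s ler_pdivrMr// mulrAC ler_pdivlMr// -expr2.
  by rewrite [leRHS]mulrC.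
have [n0 rn0] : exists n0, r < s n0.
  apply/not_existsP => sr; apply: NO; apply: (@geometric_Q1_O1 _ r).
  elim=> [|n IH]; first by rewrite N01 expr0.
  have /negP := sr n; rewrite -leNgt /s ler_pdivrMr// exprS => /le_trans; apply.
  by rewrite ler_wpM2l// ltW.
have sn0 k : r < s (n0 + k)%N.
  elim: k => [|k IH]; first by rewrite addn0.
  by rewrite addnS (lt_le_trans IH).
pose W := 1 + \sum_(i < n0.+1) r ^+ i / N i.
have Wge i : (i <= n0)%N -> r ^+ i / N i <= W.
  move=> i0; rewrite /W (bigD1 (Ordinal (i0 : i < n0.+1)%N))//= addrCA lerDl.
  by rewrite addr_ge0// sumr_ge0// => j _; rewrite divr_ge0// ?exprn_ge0 ?ltW.
have W0 : 0 < W.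
  by rewrite ltr_wpDr// sumr_ge0// => j _; rewrite divr_ge0// ?exprn_ge0 ?ltW.
exists W => // n; have [/Wge|nn] := leqP n n0; first by rewrite ler_pdivrMr.
rewrite -(subnKC (ltnW nn)); elim: (n - n0)%N => [|k IH].
  by rewrite addn0 -ler_pdivrMr// Wge.
rewrite addnS exprS (@le_trans _ _ (r * (W * N (n0 + k)%N)))//.
  by rewrite ler_wpM2l// ltW.
rewrite mulrCA ler_wpM2l ?(ltW W0)//.
by have /ltW := sn0 k; rewrite /s ler_pdivlMr.
Qed.

End Taylor.

(** * Baire category in the Cantor space *)

Definition agree_below (n : nat) (c c' : nat -> bool) := forall i, (i < n)%N -> c i = c' i.

(* Baire's theorem in the Cantor space, whose basic open sets are the sets
   [agree_below n c]. *)
Lemma cantor_baire (P : nat -> (nat -> bool) -> Prop) :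
  (forall m c n, exists c' n', agree_below n c c' /\
    forall c'', agree_below n' c' c'' -> ~ P m c'') ->
  exists c, forall m, ~ P m c.
Proof.
move=> step.
have {}step (z : nat * ((nat -> bool) * nat)) : exists z' : (nat -> bool) * nat,
    [/\ (z.2.2 < z'.2)%N, agree_below z.2.2 z.2.1 z'.1 &
     forall c, agree_below z'.2 z'.1 c -> ~ P z.1 c].
  case: z => m [c n]; have [c' [n' [cc' Pc']]] := step m c n.
  (* The maximum with [n.+1] makes the prefixes grow strictly, so every coordinate is eventually
     fixed. *)
  exists (c', maxn n.+1 n'); split => //=; first by rewrite leq_max leqnn.
  by move=> c'' H; apply: Pc' => i ni; apply: H; rewrite leq_max ni orbT.
have [nxt nxtP] := choice step.
pose fix st m := if m is k.+1 then nxt (k, st k) else (fun=> false, 0%N).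
have st_le m : (m <= (st m).2)%N.
  by elim: m => // m IH; have [+ _ _] := nxtP (m, st m); exact: leq_ltn_trans.
have st_mono m j : ((st m).2 <= (st (m + j)).2)%N.
  elim: j => [|j IH]; first by rewrite addn0.
  by rewrite addnS; have [/ltnW + _ _] := nxtP ((m + j)%N, st (m + j)%N); exact: leq_trans.
have st_agree m j : agree_below (st m).2 (st m).1 (st (m + j)%N).1.
  elim: j => [|j IH] i im; first by rewrite addn0.
  rewrite (IH i im) addnS; have [_ + _] := nxtP ((m + j)%N, st (m + j)%N).
  by apply => /=; exact: leq_trans (st_mono m j).
(* Coordinate [i] is read at stage [i.+1], the first one whose prefix is certain to contain it. *)
exists (fun i => (st i.+1).1 i) => m.
have [_ _] := nxtP (m, st m); apply=> i /= im.
rewrite -[nxt _]/(st m.+1) in im *.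
rewrite (st_agree _ i.+1 i im) [in RHS](st_agree i.+1 m.+1); last exact: st_le.
by rewrite addnC.
Qed.

(** * The sums of poles, and a choice of poles whose sum does not extend *)

Section NonExtendable.
Variables (R : realType) (M a w : nat -> R) (Mp : nat -> nat -> R).
Hypotheses (M0 : M 0%N = 1) (M_ge0 : forall n, 0 <= M n).
Hypotheses (a_gt0 : forall k, 0 < a k) (w_gt0 : forall k, 0 < w k).
Hypothesis w_small : forall k n, w k * (a k)^-1 ^+ n.+1 <= 2^-1 ^+ k * M n.

Let pole k n x := (-1) ^+ n * n`!%:R * (x + a k)^-1 ^+ n.+1 : R.

Definition pole_sum (c : nat -> bool) K n x :=
  \sum_(k < K) (c k)%:R * w k * pole k n x.

Let geo K : \sum_(k < K) 2^-1 ^+ k <= 2 :> R.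
Proof.
suff -> : \sum_(k < K) 2^-1 ^+ k = 2 - 2 * 2^-1 ^+ K :> R.
  by rewrite lerBlDr lerDl mulr_ge0// exprn_ge0.
elim: K => [|K IH]; first by rewrite big_ord0 expr0; lra.
by rewrite big_ord_recr /= IH exprS; lra.
Qed.

(** By [w_small], the derivative of order [n] of the term [k] is at most [2^-1 ^+ k * n! * M n] on
    [[0, 1]], and the geometric weights sum to at most 2. The bounds depend neither on [K] nor on
    [c]. *)
Lemma pole_sum_jet c K :
  jet 0 1 (pole_sum c K) (dcbound 2 1 M) (fun n => dcbound 2 1 M n.+2).
Proof.
suff H : jet 0 1 (pole_sum c K)
    (fun n => \sum_(k < K) 2^-1 ^+ k * (n`!%:R * M n))
    (fun n => \sum_(k < K) 2^-1 ^+ k * (n.+2`!%:R * M n.+2)).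
  apply: jet_le H => n; rewrite -mulr_suml /dcbound expr1n mulr1 -[leRHS]mulrA;
    by rewrite ler_wpM2r// mulr_ge0.
elim: K => [|K IH].
  have -> : pole_sum c 0 = fun _ _ => 0.
    by apply/funext => n; apply/funext => x; rewrite /pole_sum big_ord0.
  by apply: jet_le (@jet0 R 0 1) => n; rewrite big_ord0.
have -> : pole_sum c K.+1 =
    fun n x => pole_sum c K n x + (c K)%:R * w K * pole K n x.
  by apply/funext => n; apply/funext => x; rewrite /pole_sum big_ord_recr.
have b1 : `|(c K)%:R * w K| <= w K.
  by rewrite normrM !ger0_norm ?(ltW (w_gt0 _))// ler_piMl ?(ltW (w_gt0 _))// lern1 leq_b1.
have A0 n : 0 <= (a K)^-1 ^+ n by rewrite exprn_ge0// invr_ge0 ltW.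
apply: jet_le (jetD IH (jetZ ((c K)%:R * w K) (jet_pole (a_gt0 K)))) => n;
  rewrite big_ord_recr /= lerD2l.
  rewrite mulrCA [leRHS]mulrCA ler_wpM2l//.
  by rewrite (le_trans _ (w_small K n))// ler_wpM2r.
rewrite mulrCA [leRHS]mulrCA ler_wpM2l//.
by rewrite (le_trans _ (w_small K n.+2))// ler_wpM2r.
Qed.

Variable U : set_system nat.
Hypotheses (UU : UltraFilter U) (U_oo : \oo `<=` U).
Let PU : ProperFilter U := ultra_proper.

(** An ultralimit exists at every order by boundedness alone, and [jet_lim] then shows that these
    limits are the successive derivatives of the sum. *)
Definition pole_series (c : nat -> bool) n x := lim (pole_sum c K n x @[K --> U]).

Lemma pole_series_jet c :
  jet 0 1 (pole_series c) (dcbound 2 1 M) (fun n => dcbound 2 1 M n.+2).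
Proof. by apply: jet_lim => K; exact: pole_sum_jet. Qed.

Lemma pole_series_cvg c x : x \in `[0, 1] ->
  pole_sum c K 0%N x @[K --> U] --> pole_series c 0%N x.
Proof.
move=> x01; apply: (@ultra_bounded_cvg _ _ _ UU _ (dcbound 2 1 M 0%N)) => K.
by have [/(_ x x01)] := pole_sum_jet c K 0%N.
Qed.

Lemma pole_series_flip (c c' : nat -> bool) k x : x \in `[0, 1] -> c k -> ~~ c' k ->
  (forall i, i != k -> c i = c' i) ->
  pole_series c 0%N x - pole_series c' 0%N x = w k / (x + a k).
Proof.
move=> x01 ck c'k cc'.
have H : pole_sum c K 0%N x - pole_sum c' K 0%N x @[K --> U] -->
  pole_series c 0%N x - pole_series c' 0%N x by apply: cvgB; exact: pole_series_cvg.
rewrite -(cvg_lim (@Rhausdorff R) H); apply/cvg_lim; first exact: Rhausdorff.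
apply: cvg_near_cst; apply: U_oo.
exists k.+1 => // K /= kK.
rewrite /pole_sum -sumrB (bigD1 (Ordinal kK))//= big1 ?addr0.
  rewrite ck (negbTE c'k) !mul0r subr0 mul1r /pole.
  by rewrite expr0 fact0 !mul1r expr1.
by move=> i ik; rewrite cc' ?subrr.
Qed.

Lemma pole_series_close c c' n x : x \in `[0, 1] -> agree_below n c c' ->
  `|pole_series c 0%N x - pole_series c' 0%N x| <= 2 * 2^-1 ^+ n.
Proof.
move=> x01 cc'.
have H : pole_sum c K 0%N x - pole_sum c' K 0%N x @[K --> U] -->
  pole_series c 0%N x - pole_series c' 0%N x by apply: cvgB; exact: pole_series_cvg.
apply: (cvgr_to_le (cvg_norm H)); apply: U_oo.
exists n => // K /= /subnKC <-.
(* The exact geometric sum of the terms from [n] to [K - 1] is a bound that can be proved by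
   induction. *)
apply: (@le_trans _ _ (2 * 2^-1 ^+ n - 2 * 2^-1 ^+ (n + (K - n)))); last first.
  by rewrite lerBlDr lerDl mulr_ge0// exprn_ge0.
elim: (K - n)%N => [|j IH].
  rewrite addn0 subrr /pole_sum -sumrB big1 ?normr0// => i _.
  by rewrite cc' ?subrr.
rewrite addnS /pole_sum !big_ord_recr /= -!/(pole_sum _ _ _ _) opprD addrACA.
rewrite (le_trans (ler_normD _ _))//.
have -> : 2 * 2^-1 ^+ n - 2 * 2^-1 ^+ (n + j).+1 =
  (2 * 2^-1 ^+ n - 2 * 2^-1 ^+ (n + j)) + 2^-1 ^+ (n + j) :> R.
  by rewrite exprS; lra.
rewrite lerD//.
set k := (n + j)%N.
have x0 : 0 <= x by move: x01; rewrite in_itv/= => /andP[].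
have xa : (x + a k)^-1 <= (a k)^-1 by rewrite lef_pV2 ?posrE ?lerDr ?ltr_wpDl.
have xa0 : 0 <= (x + a k)^-1 by rewrite invr_ge0 addr_ge0// ltW.
rewrite -mulrBl -mulrBl normrM /pole expr0 fact0 !mul1r expr1 (ger0_norm xa0).
have := w_small k 0%N; rewrite M0 mulr1 expr1; apply: le_trans.
rewrite ler_pM//; last first.
  rewrite normrM (gtr0_norm (w_gt0 k)) ler_piMl ?(ltW (w_gt0 _))//.
  by case: (c k); case: (c' k); rewrite ?subrr ?subr0 ?sub0r ?normrN ?normr0 ?normr1.
Qed.

Let C (m : nat) : R := m.+1%:R.

(** The set [A_m]: one integer controls the radius, both constants and the index of the class, so
    countably many sets suffice. The jet form makes the condition stable under limits. *)
Definition extends_with m c := exists d : nat -> R -> R,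
  jet (- (C m)^-1) (C m)^-1 d (dcbound (C m) (C m) (Mp m))
    (fun n => dcbound (C m) (C m) (Mp m) n.+2) /\
  forall x, 0 <= x <= (C m)^-1 -> d 0%N x = pole_series c 0%N x.

Let C_gt0 m : 0 < C m. Proof. by rewrite ltr0Sn. Qed.

Let C_le1 m : (C m)^-1 <= 1.
Proof. by rewrite invf_le1// ler1n. Qed.

(** The extensions attached to approximations of [c] share their bounds, so their ultralimit is a
    jet with the same bounds; by [pole_series_close] it has the right values on the right of 0. *)
Lemma extends_with_closed m c :
  (forall n, exists2 c', agree_below n c c' & extends_with m c') ->
  extends_with m c.
Proof.
move=> H.
have {}H n : exists d, jet (- (C m)^-1) (C m)^-1 d (dcbound (C m) (C m) (Mp m))
    (fun n => dcbound (C m) (C m) (Mp m) n.+2) /\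
    forall x, 0 <= x <= (C m)^-1 ->
      `|pole_series c 0%N x - d 0%N x| <= 2 * 2^-1 ^+ n.
  have [c' cc' [d [dj dx]]] := H n; exists d; split=> // x xm.
  rewrite dx//; apply: pole_series_close cc'; rewrite in_itv/=.
  by case/andP: xm => -> /le_trans; apply.
have [d dP] := choice H.
exists (fun n x => lim (d k n x @[k --> U])); split.
  by apply: jet_lim => k; have [] := dP k.
move=> x xm; apply/cvg_lim => //.
have : (fun n => 2 * 2^-1 ^+ n : R) @ U --> 0.
  apply: cvg_trans (cvg_geometric 2 (z := 2^-1) _); last by rewrite ger0_norm//; lra.
  by apply: cvg_app; exact: U_oo.
move=> /cvgrPdist_le g0; apply/cvgrPdist_le => e e0; apply: filterS (g0 e e0) => k.
rewrite sub0r normrN => /(le_trans (ler_norm _)); apply: le_trans.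
by have [_ /(_ x xm)] := dP k.
Qed.

Hypotheses (Mp0 : forall p, Mp p 0%N = 1)
  (Mp_incr : forall p n, Mp p n <= Mp p n.+1)
  (Mp_qa : forall p, quasianalytic (Mp p)).

Lemma extends_with_flip m (c c' : nat -> bool) k : a k < (C m)^-1 -> c k -> ~~ c' k ->
  (forall i, i != k -> c i = c' i) -> extends_with m c -> extends_with m c' -> False.
Proof.
move=> akm ck c'k cc' [d [dj dx]] [d' [dj' dx']].
have m0 : 0 < (C m)^-1 by rewrite invr_gt0.
have := jetD dj (jetZ (-1) dj').
set u := (u in jet _ _ u); set E := (E in jet _ _ _ _ E) => uj.
have {}uj : jet (- (C m)^-1) (C m)^-1 u (dcbound (C m + `|-1| * C m) (C m) (Mp m)) E.
  by apply: jet_le uj => // n; rewrite dcboundZ dcboundD.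
have CC : 0 < C m + `|-1| * C m.
  by rewrite addr_gt0// mulr_gt0// normrN normr1.
have := quasianalytic_no_pole (@Mp_qa m) (Mp0 m) (Mp_incr m) CC (C_gt0 m) m0
  (a_gt0 k) akm (C_le1 m) (lt0r_neq0 (w_gt0 k)) uj.
apply.
move=> x /andP[x0 xm].
have x01 : x \in `[0, 1] by rewrite in_itv/= x0 (le_trans (ltW xm)).
have xm' : 0 <= x <= (C m)^-1 by rewrite x0 ltW.
by rewrite /u mulN1r dx// dx'// (pole_series_flip x01 ck c'k cc').
Qed.

Hypothesis a_small : forall m n, exists2 k, (n <= k)%N & a k < (C m)^-1.

Lemma exists_non_extendable : exists c, forall m, ~ extends_with m c.
Proof.
apply: cantor_baire => m c n.
have [k nk akm] := a_small m n.
have [c' cc' Pc'] : exists2 c', agree_below n c c' & ~ extends_with m c'.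
  (* The two choices at coordinate [k] differ by one pole inside the interval of extension, so at
     most one of them lies in [A_m]. *)
  pose cb b i := if i == k then b else c i.
  have cbE b : agree_below n c (cb b).
    by move=> i i_n; rewrite /cb ifN// neq_ltn (leq_trans i_n nk).
  have [P1|P1] := pselect (extends_with m (cb true)); last by exists (cb true).
  exists (cb false) => //; apply: (extends_with_flip akm _ _ _ P1).
  - by rewrite /cb eqxx.
  - by rewrite /cb eqxx.
  - by move=> i /negbTE ik; rewrite /cb ik.
(* The complement of [A_m] is open. *)
have [n' Pn'] : exists n', forall c'', agree_below n' c' c'' -> ~ extends_with m c''.
  apply/not_existsP => Pn'; apply: Pc'; apply: extends_with_closed => n'.
  have /existsNP[c'' /not_implyP[c'c'' /contrapT Pc'']] := Pn' n'.
  by exists c''.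
by exists c', n'.
Qed.

End NonExtendable.

(** * Choice of the weights, and reduction of an arbitrary extension to some [A_m] *)

Theorem theorem3p3 (R : realType) (M : nat -> R) (Mp : nat -> nat -> R)
  (M_lc : log_convex M)
  (M_incr : forall n, M n <= M n.+1)
  (M0 : M 0%N = 1)
  (Mp_lc : forall p, log_convex (Mp p))
  (Mp0 : forall p, Mp p 0%N = 1)
  (Mp_incr : forall p n, Mp p n <= Mp p n.+1)
  (Mp_family_incr : forall p q j, (p <= q)%N -> Mp p j <= Mp q j)
  (Mp_qa : forall p, quasianalytic (Mp p))
  (O1_proper : O1 R `<` Q1 M)
  (Q1_sub : Q1 M `<=` \bigcup_p Q1 (Mp p)) :
  exists2 H, Q1plus M H & forall p G, Q1 (Mp p) G -> ~ extends_to H G.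
Proof.
have M_gt0 : forall n, 0 < M n by case: M_lc.
pose a k : R := k.+1%:R^-1.
have a_gt0 k : 0 < a k by rewrite invr_gt0.
have /choice[W WP] : forall k, exists W,
    0 < W /\ forall n, k.+1%:R ^+ n <= W * M n.
  move=> k.
  have [|W W0 WM] := log_convex_growth M_lc _ M0 (ltr0Sn R k); last by exists W.
  by case: O1_proper.
(* Since [(a k)^-1 = k.+1], the product [w k * (a k)^-1 ^+ n.+1] is [2^-1 ^+ k * k.+1 ^+ n / W k],
   which the growth of [M] bounds by [2^-1 ^+ k * M n]. *)
pose w k : R := 2^-1 ^+ k / (k.+1%:R * W k).
have w_gt0 k : 0 < w k.
  by rewrite divr_gt0 ?exprn_gt0// mulr_gt0//; case: (WP k).
have w_small k n : w k * (a k)^-1 ^+ n.+1 <= 2^-1 ^+ k * M n.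
  have [W0 /(_ n) WM] := WP k.
  rewrite /w /a invrK exprS.
  have -> : 2^-1 ^+ k / (k.+1%:R * W k) * (k.+1%:R * k.+1%:R ^+ n) =
    2^-1 ^+ k * (k.+1%:R ^+ n / W k) :> R.
    by field; rewrite (gt_eqF W0) /= nat1r pnatr_eq0.
  by rewrite ler_wpM2l ?exprn_ge0// ler_pdivrMr// mulrC.
have a_small m n : exists2 k, (n <= k)%N & a k < m.+1%:R^-1.
  exists (maxn n m.+1); rewrite ?leq_maxl// /a ltf_pV2 ?posrE// ltr_nat ltnS.
  exact: leq_maxr.
have [U [UU U_oo]] := ultraFilterLemma (@eventually_filter).
have [c cP] := exists_non_extendable M0 (fun n => ltW (M_gt0 n)) a_gt0 w_gt0 w_small
  UU U_oo Mp0 Mp_incr Mp_qa a_small.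
pose F := pole_series a w U c 0%N.
exists (rgerm F).
  exists 1, F; split=> //.
  apply: (jet_DC _ _ (pole_series_jet (fun n => ltW (M_gt0 n)) a_gt0 w_gt0 w_small UU c)) => //.
move=> p G [e [f [e0 /DC_jet[d [C [r [C0 r0 df dj]]]] ->]]] [g fg FG].
have gF : \forall x \near 0, 0 <= x -> g x = F x.
  have : rgerm F F by apply: filterE.
  by rewrite FG.
have /nbhs_ballP[t /= t0 tP] : \forall x \near 0, f x = g x /\ (0 <= x -> g x = F x).
  by apply: filterS2 fg gF.
(* An [m] above [p] and this sum dominates both constants, and [m.+1^-1] fits in both
   neighbourhoods; as the weights increase with the index, the extension witnesses membership in
   [A_m]. *)
pose X := C + r + e^-1 + t^-1.
pose m := maxn p (Num.bound X).
have X0 : 0 <= X by rewrite /X !addr_ge0// ?invr_ge0 ltW.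
have Xm : X < m.+1%:R.
  rewrite (lt_le_trans (archi_boundP X0))// ler_nat ltnW// ltnS.
  exact: leq_maxr.
have [ei ti] : 0 < e^-1 /\ 0 < t^-1 by rewrite !invr_gt0.
have [Cm rm em tm] : [/\ C <= m.+1%:R, r <= m.+1%:R, m.+1%:R^-1 <= e & m.+1%:R^-1 < t].
  split; [by move: Xm; rewrite /X; lra|by move: Xm; rewrite /X; lra| |].
    by rewrite -(invrK e) lef_pV2 ?posrE//; move: Xm; rewrite /X; lra.
  by rewrite -(invrK t) ltf_pV2 ?posrE//; move: Xm; rewrite /X; lra.
apply: (cP m); exists d; split.
  have B n : dcbound C r (Mp p) n <= dcbound m.+1%:R m.+1%:R (Mp m) n.
    have Mp_ge0 : 0 <= Mp p n by case: (Mp_lc p) => /(_ n) /ltW.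
    rewrite /dcbound ler_pM ?mulr_ge0 ?exprn_ge0 ?(ltW C0) ?(ltW r0)//; last first.
      by apply: Mp_family_incr; exact: leq_maxl.
    rewrite ler_wpM2r// ler_pM ?exprn_ge0 ?(ltW C0) ?(ltW r0)//.
    by rewrite lerXn2r ?nnegrE// ltW.
  by apply: jet_le (jet_sub _ em dj) => //; rewrite lerN2.
move=> x /andP[x0 xm].
have xt : ball 0 t x by rewrite /ball /= sub0r normrN ger0_norm// (le_lt_trans xm).
have xe : x <= e := le_trans xm em.
have [fgx gFx] := tP x xt.
by rewrite df ?fgx ?gFx// in_itv/=; lra.
Qed.
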